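(* There exist a Jordan domain $\Omega\subset\mathbb{C}$ and a function $f\in A(\Omega)$ such that the antiderivative of $f$ is not bounded on $\Omega$.
   Context: A Jordan domain is the bounded domain enclosed by a Jordan (simple closed) curve in $\mathbb{C}$. $A(\Omega)$ is the set of functions holomorphic on $\Omega$ which extend continuously to $\overline{\Omega}$. An antiderivative of $f$ on $\Omega$ is a holomorphic $F$ on $\Omega$ with $F'=f$; it is unique up to an additive constant, which does not affect the conclusion. *)

(* Defs.v *)
From HB Require Import structures.
From mathcomp Require Import all_boot all_order all_algebra complex.
From mathcomp Require Import all_classical all_reals all_analysis.

Set Implicit Arguments.
Unset Strict Implicit.
Unset Printing Implicit Defensive.

Import Order.TTheory GRing.Theory Num.Theory.
Import numFieldNormedType.Exports.

Local Open Scope classical_set_scope.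
Local Open Scope ring_scope.

(* [R[i]] carries no topology when written directly: the topology and norm of
   a field are only found on the carrier of a [numFieldType] that is kept
   folded, which is the purpose of this constant. Its norm is the complex
   modulus, with values on the nonnegative real axis of [R[i]]. *)
Definition Cplx (R : realType) : numClosedFieldType := R[i].

Section JordanDomains.
Variable R : realType.
Local Notation C := (Cplx R).

Definition is_jordan_curve (J : set C) : Prop :=
  exists gamma : R -> C,
    [/\ {within `[0, 1], continuous gamma},
        gamma 0 = gamma 1,
        {in `[0, 1[ &, injective gamma} &
        J = gamma @` `[0, 1]].

(* By the Jordan curve theorem, the complement of [J] has exactly one bounded
   connected component, so this determines [Omega] from [J]. *)
Definition is_jordan_domain (Omega : set C) : Prop :=
  exists2 J : set C, is_jordan_curve J &
    bounded_set Omega /\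
    (exists2 z : C, (~` J) z & Omega = connected_component (~` J) z).

(* [derivable f z 1] is taken over the scalar field [C]: the increment tends
   to 0 in the complex plane, so this is complex differentiability. It is
   the usual notion of holomorphy when [Omega] is open. *)
Definition holomorphic_on (Omega : set C) (f : C -> C) : Prop :=
  forall z : C, Omega z -> derivable f z 1.

(* Only the values of [f] on [Omega] matter. *)
Definition in_A (Omega : set C) (f : C -> C) : Prop :=
  holomorphic_on Omega f /\
  exists2 g : C -> C,
    {within closure Omega, continuous g} &
    forall z : C, Omega z -> g z = f z.

Definition antiderivative_on (Omega : set C) (f F : C -> C) : Prop :=
  holomorphic_on Omega F /\ forall z : C, Omega z -> derive1 F z = f z.

Definition bounded_on (Omega : set C) (F : C -> C) : Prop :=
  [bounded F z | z in Omega].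

End JordanDomains.

(* Main.v *)
(* The domain is a thin spiral of infinite length winding into 0. Write
   [E w = exp(i w)]; in the coordinate [w = x + iy] the circle arguments are
   unwound and [|E w| = exp(- y)]. With [t = exp(2 y) - x], the set [0 < t < 1]
   is a strip around the graph of [y = (log x) / 2], so narrow that [E] is
   injective on it; the domain is the image of the part [x t (1 - t) > 1] of
   that strip, bounded by the Jordan curve obtained from [x t (1 - t) = 1].
   The function is [F z = - i log w] for [z = E w], of derivative
   [f z = - 1 / (w z)]. Since [|z| = (x + t)^(-1/2)] and [|w| >= x], one has
   [|f z| <= 2 |z|], so that [f] extends continuously by 0 at 0, the only
   point where it could fail to; but [|F z| >= log x] is unbounded. *)
Require Import Defs.
From mathcomp Require Import all_boot all_order all_algebra complex.
From mathcomp Require Import all_classical all_reals all_analysis.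
From mathcomp Require Import ring lra.

Set Implicit Arguments.
Unset Strict Implicit.
Unset Printing Implicit Defensive.

Import Order.TTheory GRing.Theory Num.Theory.
Import numFieldNormedType.Exports.

Local Open Scope classical_set_scope.
Local Open Scope ring_scope.

(** * Complex or real derivatives through continuous slope functions *)

Section Slopes.
Variable K : numFieldType.
Implicit Types (f g h : K -> K) (x a : K).

(** Carathéodory's criterion: once [h] is continuous at [x], the difference quotient agrees with [h]
    off [x] and so tends to [h x]. With its converse below, the chain and inverse function rules
    become algebra on slopes. *)
Lemma is_derive_slope f h x :
  (\forall z \near x, f z - f x = h z * (z - x)) -> {for x, continuous h} ->
  is_derive x 1 f (h x).
Proof.
move=> fE hc.
have lim : t^-1 *: ((f \o shift x) (t *: 1) - f x) @[t --> 0^'] --> h x.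
  have : (h \o shift x) t @[t --> 0^'] --> h x.
    exact/continuous_withinNshiftx.
  apply: cvg_trans; apply: near_eq_cvg.
  have {}fE : \forall t \near 0^', f (t + x) - f x = h (t + x) * t.
    apply: cvg_within; move/nbhs0P: fE; apply: filterS => t /=.
    by rewrite [x + t]addrC addrK.
  near=> t.
  have t0 : t != 0 by near: t; exact: nbhs_dnbhs_neq.
  by rewrite /= [t *: 1]mulr1 (near fE t)//= [RHS]mulrC mulfK.
have <- : 'D_1 f x = h x by apply: cvg_lim.
constructor=> //.
by apply/cvg_ex; exists (h x).
Unshelve. all: by end_near. Qed.

Lemma is_derive_slopeP f x a : is_derive x 1 f a ->
  exists h, [/\ forall z, f z - f x = h z * (z - x),
                {for x, continuous h} & h x = a].
Proof.
move=> [df fa].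
exists (fun z => if z == x then a else (f z - f x) / (z - x)).
split; last by rewrite eqxx.
  move=> z; case: eqVneq => [->|zx]; first by rewrite !subrr mulr0.
  by rewrite divfK// subr_eq0.
apply/continuous_withinNshiftx; rewrite eqxx/=.
have : t^-1 *: ((f \o shift x) (t *: 1) - f x) @[t --> 0^'] --> a.
  by rewrite -fa; exact: df.
apply: cvg_trans; apply: near_eq_cvg; near=> t.
have t0 : t != 0 by near: t; exact: nbhs_dnbhs_neq.
by rewrite /= -subr_eq0 addrK (negPf t0) [t *: 1]mulr1 mulrC.
Unshelve. all: by end_near. Qed.

Lemma is_derive_compose f g x a b :
  is_derive (g x) 1 f a -> is_derive x 1 g b -> is_derive x 1 (f \o g) (a * b).
Proof.
move=> /is_derive_slopeP[h [fE hc <-]] dg.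
have gc : {for x, continuous g}.
  exact/differentiable_continuous/derivable1_diffP.
move: dg => /is_derive_slopeP[k [gE kc <-]].
apply: (@is_derive_slope _ (fun z => h (g z) * k z)).
  by near=> z; rewrite /= fE gE mulrA.
apply: continuousM => //.
exact: continuous_comp.
Unshelve. all: by end_near. Qed.

(** Substituting [g z] in the slope identity of [f] gives [z - y = h (g z) * (g z - x)], so
    [(h (g z))^-1] is a slope of [g]; it is continuous at [y] because [h x = a] is nonzero. *)
Lemma is_derive_local_inverse f g x y a :
  g y = x -> f x = y -> {for y, continuous g} ->
  (\forall z \near y, f (g z) = z) ->
  is_derive x 1 f a -> a != 0 -> is_derive y 1 g a^-1.
Proof.
move=> gy fx gc fg /is_derive_slopeP[h [fE hc hx]] a0.
have hgc : {for y, continuous (h \o g)}.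
  by apply: continuous_comp => //; rewrite gy.
have hgy : h (g y) = a by rewrite gy.
rewrite -hgy.
apply: (@is_derive_slope _ (fun z => (h (g z))^-1)); last first.
  by apply: continuousV => //; rewrite hgy.
have hg0 : \forall z \near y, h (g z) != 0.
  by apply: (@cvgr_neq0 _ K _ (nbhs y) _ (h \o g) _ hgc); rewrite /= hgy.
near=> z.
have hz : h (g z) != 0 by near: z.
have := fE (g z).
rewrite (near fg z)// fx => ->.
by rewrite gy mulrA mulVf// mul1r.
Unshelve. all: by end_near. Qed.

End Slopes.

(** * Real coordinates, modulus and limits in the complex plane *)

Section Plane.
Variable R : realType.
Local Notation C := (Cplx R).
Implicit Types (z w : C) (x y : R).

Definition cpx (x y : R) : C := Complex x y.
Definition cre (z : C) : R := complex.Re z.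
Definition cim (z : C) : R := complex.Im z.
(** The norm of [C] takes values in [C]; this is the same modulus as an element of [R], where real
    inequalities can be used. *)
Definition cmod (z : C) : R := Num.sqrt (cre z ^+ 2 + cim z ^+ 2).

Lemma cpxK z : cpx (cre z) (cim z) = z.
Proof. by case: z. Qed.

Lemma cpx_inj x y x' y' : cpx x y = cpx x' y' -> x = x' /\ y = y'.
Proof. by case. Qed.

Lemma cpxD x y x' y' : cpx x y + cpx x' y' = cpx (x + x') (y + y').
Proof. by []. Qed.

Lemma cpxB x y x' y' : cpx x y - cpx x' y' = cpx (x - x') (y - y').
Proof. by []. Qed.

Lemma cpxM x y x' y' :
  cpx x y * cpx x' y' = cpx (x * x' - y * y') (x * y' + y * x').
Proof. by []. Qed.

Lemma creB z w : cre (z - w) = cre z - cre w.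
Proof. by case: z; case: w. Qed.

Lemma cimB z w : cim (z - w) = cim z - cim w.
Proof. by case: z; case: w. Qed.

Lemma normC_cmod z : `|z| = cpx (cmod z) 0.
Proof. exact: normc_def. Qed.

Lemma cmod_ge0 z : 0 <= cmod z.
Proof. exact: sqrtr_ge0. Qed.

Lemma ltC_real x y : (cpx x 0 < cpx y 0) = (x < y).
Proof. exact: ltcR. Qed.

Lemma leC_real x y : (cpx x 0 <= cpx y 0) = (x <= y).
Proof. exact: lecR. Qed.

Lemma cmodM z w : cmod (z * w) = cmod z * cmod w.
Proof.
have /cpx_inj[] // : cpx (cmod (z * w)) 0 = cpx (cmod z * cmod w) 0.
by rewrite -normC_cmod normrM !normC_cmod cpxM !mulr0 mul0r subr0 addr0.
Qed.

Lemma cmodD z w : cmod (z + w) <= cmod z + cmod w.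
Proof.
have := ler_normD z w.
by rewrite !normC_cmod cpxD addr0 leC_real.
Qed.

Lemma cmodN z : cmod (- z) = cmod z.
Proof.
have : cpx (cmod (- z)) 0 = cpx (cmod z) 0 by rewrite -!normC_cmod normrN.
by case/cpx_inj.
Qed.

Lemma cmod_eq0 z : (cmod z == 0) = (z == 0).
Proof.
rewrite -[z == 0]normr_eq0 normC_cmod; apply/eqP/eqP => [->//|].
by move=> /cpx_inj[].
Qed.

Lemma cmodV z : cmod z^-1 = (cmod z)^-1.
Proof.
have [->|z0] := eqVneq z 0.
  have /eqP -> : cmod (0 : C) == 0 by rewrite cmod_eq0.
  by rewrite !invr0; apply/eqP; rewrite cmod_eq0.
apply: (mulfI (_ : cmod z != 0)); first by rewrite cmod_eq0.
rewrite -cmodM !mulfV ?cmod_eq0//.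
by rewrite /cmod /= expr1n expr0n addr0 sqrtr1.
Qed.

Lemma cre_le_cmod z : `|cre z| <= cmod z.
Proof. by rewrite -sqrtr_sqr ler_wsqrtr// lerDl sqr_ge0. Qed.

Lemma cim_le_cmod z : `|cim z| <= cmod z.
Proof. by rewrite -sqrtr_sqr ler_wsqrtr// lerDr sqr_ge0. Qed.

Lemma cmod_le_cpx x y : cmod (cpx x y) <= `|x| + `|y|.
Proof.
rewrite -[leRHS]ger0_norm ?addr_ge0// -sqrtr_sqr ler_wsqrtr//= sqrrD.
by rewrite !real_normK ?num_real// lerD2r lerDl mulrn_wge0// mulr_ge0.
Qed.

Lemma gt0_real (e : C) : 0 < e -> exists2 r : R, 0 < r & e = cpx r 0.
Proof.
case: e => r i; rewrite ltcE /= => /andP[/eqP-> r0].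
by exists r.
Qed.

Section Cvg.
Context {T : Type} {F : set_system T} {FF : Filter F}.

Lemma cvg_cmodP (f : T -> C) z : f @ F --> z <->
  forall e, 0 < e -> \forall t \near F, cmod (z - f t) < e.
Proof.
split=> [/cvgrPdist_lt fz e e0|fz].
  have := fz (cpx e 0); rewrite ltC_real => /(_ e0).
  by apply: filterS => t; rewrite normC_cmod ltC_real.
apply/cvgrPdist_lt => _ /gt0_real[e e0 ->].
by have := fz e e0; apply: filterS => t; rewrite normC_cmod ltC_real.
Qed.

Lemma cvg_cpx (a b : T -> R) x y : a @ F --> x -> b @ F --> y ->
  (fun t => cpx (a t) (b t)) @ F --> cpx x y.
Proof.
move=> ax bY; apply/cvg_cmodP => e e0.
have e20 : 0 < e / 2 by rewrite divr_gt0.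
near=> t.
rewrite cpxB (le_lt_trans (cmod_le_cpx _ _))// [e]splitr ltrD//; near: t.
  by move/cvgrPdist_lt : ax; exact.
by move/cvgrPdist_lt : bY; exact.
Unshelve. all: by end_near. Qed.

Lemma cvg_cre (f : T -> C) z : f @ F --> z -> (cre \o f) @ F --> cre z.
Proof.
move=> /cvg_cmodP fz; apply/cvgrPdist_lt => e /fz; apply: filterS => t.
by apply: le_lt_trans; rewrite -creB cre_le_cmod.
Qed.

Lemma cvg_cim (f : T -> C) z : f @ F --> z -> (cim \o f) @ F --> cim z.
Proof.
move=> /cvg_cmodP fz; apply/cvgrPdist_lt => e /fz; apply: filterS => t.
by apply: le_lt_trans; rewrite -cimB cim_le_cmod.
Qed.

End Cvg.

Lemma cre_continuous : continuous cre.
Proof. by move=> z; exact: (@cvg_cre _ (nbhs z) _ id). Qed.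

Lemma cim_continuous : continuous cim.
Proof. by move=> z; exact: (@cvg_cim _ (nbhs z) _ id). Qed.

End Plane.

(** * The functions [exp (i w)] and [- i log z], and their complex derivatives *)

Lemma is_derive_near (K : numFieldType) (f : K -> K) (x a : K) :
  is_derive x 1 f a -> forall e, 0 < e ->
  \forall z \near x, `|f z - f x - a * (z - x)| <= e * `|z - x|.
Proof.
move=> /is_derive_slopeP[h [fE hc <-]] e e0.
near=> z.
rewrite fE -mulrBl normrM ler_wpM2r// distrC ltW//; near: z.
by move/cvgrPdist_lt : hc; exact.
Unshelve. all: by end_near. Qed.

Section Expi.
Variable R : realType.
Local Notation C := (Cplx R).
Implicit Types (z w : C) (x y : R).

(* [exp (i w)] *)
Definition expi w : C :=
  cpx (expR (- cim w) * cos (cre w)) (expR (- cim w) * sin (cre w)).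

Lemma expiD w z : expi (w + z) = expi w * expi z.
Proof.
case: w z => [a b] [c d].
rewrite /expi cpxM/= /cre /cim/= opprD expRD cosD sinD.
by congr cpx; ring.
Qed.

Lemma expi0 : expi 0 = 1.
Proof. by rewrite /expi/= oppr0 expR0 cos0 sin0 mul1r mulr0. Qed.

Lemma cmod_expi w : cmod (expi w) = expR (- cim w).
Proof.
rewrite /cmod /expi/= !exprMn -mulrDr cos2Dsin2 mulr1.
by rewrite sqrtr_sqr ger0_norm ?expR_ge0.
Qed.

Lemma expi_neq0 w : expi w != 0.
Proof. by rewrite -cmod_eq0 cmod_expi gt_eqF ?expR_gt0. Qed.

(** Complex differentiability at [0], obtained from the first-order expansions at [0] of the real
    functions [expR], [cos] and [sin]. *)
Lemma expi_near0 (e : R) : 0 < e ->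
  \forall h \near (0 : C), cmod (expi h - 1 - cpx 0 1 * h) <= e * cmod h.
Proof.
move=> e0.
(* The error splits into four terms, bounded by [2], [1], [2] and [1] times [e / 6 * cmod h]; the
   two factors [2] come from [expR (- cim h) <= 2]. *)
have e60 : 0 < e / 6 by rewrite divr_gt0.
have rec : {for (0 : C), continuous (@cre R)} by exact: cre_continuous.
have imc : - cim h @[h --> (0 : C)] --> (0 : R).
  rewrite -[X in _ --> X]oppr0.
  exact: (@cvgN _ _ _ (nbhs (0 : C)) _ (@cim R) _ (@cim_continuous R 0)).
have dX := is_derive_near (is_derive_expR (0 : R)) e60.
have dc := is_derive_near (is_derive_cos (0 : R)) e60.
have ds := is_derive_near (is_derive_sin (0 : R)) e60.
have X2 : \forall b \near (0 : R), `|expR b - 1| < Num.min 1 (e / 6).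
  have := @continuous_expR R 0; rewrite /continuous_at expR0.
  move=> /cvgrPdist_lt /(_ (Num.min 1 (e / 6))).
  rewrite lt_min ltr01 e60 => /(_ isT).
  by apply: filterS => b; rewrite distrC.
near=> h.
have X2' : `|expR (- cim h) - 1| < Num.min 1 (e / 6).
  by near: h; exact: (imc _ X2).
have dX' : `|expR (- cim h) - expR 0 - expR 0 * (- cim h - 0)| <=
    e / 6 * `|- cim h - 0|.
  by near: h; exact: (imc _ dX).
have dc' : `|cos (cre h) - cos 0 - - sin 0 * (cre h - 0)| <=
    e / 6 * `|cre h - 0|.
  by near: h; exact: (rec _ dc).
have ds' : `|sin (cre h) - sin 0 - cos 0 * (cre h - 0)| <=
    e / 6 * `|cre h - 0|.
  by near: h; exact: (rec _ ds).
move: X2' dX' dc' ds'.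
rewrite expR0 cos0 sin0 !subr0 oppr0 mul0r subr0 !mul1r normrN.
move=> {}X2' {}dX' {}dc' {}ds'.
set X := expR (- cim h) in X2' dX'.
have [X1 Xe] : `|X - 1| < 1 /\ `|X - 1| < e / 6.
  by move: X2'; rewrite lt_min => /andP.
have XB : `|X| <= 2.
  by rewrite -[X](subrK 1) (le_trans (ler_normD _ _))// normr1 lerD2r ltW.
have -> : expi h - 1 - cpx 0 1 * h =
  cpx (X * (cos (cre h) - 1) + (X - 1 - - cim h))
      (X * (sin (cre h) - cre h) + cre h * (X - 1)).
  rewrite -[in cpx 0 1 * h](cpxK h) /expi -/X -[1 : C]/(cpx 1 0) cpxM !cpxB.
  by congr cpx; ring.
rewrite (le_trans (cmod_le_cpx _ _))//.
have reh := cre_le_cmod h.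
have imh := cim_le_cmod h.
have B1 : `|X * (cos (cre h) - 1)| <= 2 * (e / 6 * `|cre h|).
  by rewrite normrM ler_pM.
have B2 : `|X * (sin (cre h) - cre h)| <= 2 * (e / 6 * `|cre h|).
  by rewrite normrM ler_pM.
have B3 : `|cre h * (X - 1)| <= `|cre h| * (e / 6).
  by rewrite normrM ler_wpM2l// ltW.
have B4 := ler_normD (X * (cos (cre h) - 1)) (X - 1 - - cim h).
have B5 := ler_normD (X * (sin (cre h) - cre h)) (cre h * (X - 1)).
have B6 : e / 6 * `|cre h| <= e / 6 * cmod h by rewrite ler_wpM2l// ltW.
have B7 : e / 6 * `|cim h| <= e / 6 * cmod h by rewrite ler_wpM2l// ltW.
lra.
Unshelve. all: by end_near. Qed.

(** The functional equation moves the question from [w] to [0]: [expi w * k (z - w)] is a slope at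
    [w] when [k] is the slope of [expi] at [0]. *)
Lemma is_derive_expi w : is_derive w 1 expi (cpx 0 1 * expi w).
Proof.
pose k h : C := if h == 0 then cpx 0 1 else (expi h - 1) / h.
have kc : {for (0 : C), continuous k}.
  apply/(@cvg_cmodP _ _ (nbhs (0 : C))) => e e0.
  have e20 : 0 < e / 2 by rewrite divr_gt0.
  near=> h; rewrite /k eqxx.
  case: eqVneq => [_|h0].
    by rewrite subrr; have /eqP -> : cmod (0 : C) == 0 by rewrite cmod_eq0.
  have -> : cpx 0 1 - (expi h - 1) / h = - ((expi h - 1 - cpx 0 1 * h) / h).
    by rewrite [in RHS]mulrBl mulfK// opprB.
  rewrite cmodN cmodM cmodV ltr_pdivrMr; last first.
    by rewrite lt_neqAle cmod_ge0 eq_sym cmod_eq0 h0.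
  apply: (@le_lt_trans _ _ (e / 2 * cmod h)).
    by near: h; exact: expi_near0.
  rewrite ltr_pM2r; first by rewrite ltr_pdivrMr// ltr_pMr// ltr1n.
  by rewrite lt_neqAle cmod_ge0 eq_sym cmod_eq0 h0.
have -> : cpx 0 1 * expi w = expi w * k (w - w).
  by rewrite subrr /k eqxx mulrC.
apply: (@is_derive_slope _ _ (fun z => expi w * k (z - w))).
  near=> z; have -> : expi z - expi w = expi w * (expi (z - w) - 1).
    by rewrite mulrBr mulr1 -expiD subrKC.
  rewrite -mulrA; congr (_ * _); rewrite /k; case: eqVneq => [->|zw].
    by rewrite expi0 subrr mulr0.
  by rewrite divfK.
apply: continuousM; first exact: cst_continuous.
apply: (@continuous_comp _ _ _ (fun z => z - w) k); last by rewrite subrr.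
by apply: continuousB; [exact: cvg_id|exact: cst_continuous].
Unshelve. all: by end_near. Qed.

Lemma continuous_cmod : continuous (@cmod R).
Proof.
have sq (f : C -> R) : continuous f -> continuous (fun z => f z ^+ 2).
  move=> fc z; apply: (@continuous_comp _ _ _ f (fun x => x ^+ 2)) => //.
  - exact: fc.
  - exact: exprn_continuous.
move=> z; apply: (@continuous_comp _ _ _ (fun z => cre z ^+ 2 + cim z ^+ 2)).
  by apply: continuousD; apply: sq;
    [exact: cre_continuous|exact: cim_continuous].
exact: sqrt_continuous.
Qed.

(* [- i log z], for the principal branch; meaningful only for [0 < cre z]. *)
Definition logi z : C := cpx (atan (cim z / cre z)) (- ln (cmod z)).

Lemma cre_gt0_cmod z : 0 < cre z -> 0 < cmod z.
Proof.
move=> z0; rewrite (lt_le_trans z0)// (le_trans (ler_norm _))//.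
exact: cre_le_cmod.
Qed.

Lemma logiK z : 0 < cre z -> expi (logi z) = z.
Proof.
move=> z0; have m0 := cre_gt0_cmod z0.
rewrite -[RHS]cpxK /expi/= opprK lnK// cos_atan.
have cz : cre z * Num.sqrt (1 + (cim z / cre z) ^+ 2) = cmod z.
  have {1}-> : cre z = Num.sqrt (cre z ^+ 2) by rewrite sqrtr_sqr gtr0_norm.
  rewrite -sqrtrM ?sqr_ge0//.
  congr Num.sqrt; rewrite mulrDr mulr1 -exprMn [cre z * _]mulrC divfK//.
  by rewrite gt_eqF.
have s0 : Num.sqrt (1 + (cim z / cre z) ^+ 2) != 0.
  by apply/negP => /eqP s0; move: m0; rewrite -cz s0 mulr0 ltxx.
have cE : cmod z * (Num.sqrt (1 + (cim z / cre z) ^+ 2))^-1 = cre z.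
  by rewrite -cz mulfK.
congr cpx => //.
have := atanK (cim z / cre z); rewrite /tan.
have c0 : cos (atan (cim z / cre z)) != 0 by rewrite cos_atan invr_neq0.
move=> /(canRL (divfK c0)) ->.
by rewrite cos_atan mulrCA cE divfK// gt_eqF.
Qed.

Lemma continuous_logi z : 0 < cre z -> {for z, continuous logi}.
Proof.
move=> z0.
have c1 : {for z, continuous (fun z => atan (cim z / cre z))}.
  apply: (@continuous_comp _ _ _ (fun z => cim z / cre z) atan).
    apply: continuousM; first exact: cim_continuous.
    apply: continuousV; first by rewrite gt_eqF.
    exact: cre_continuous.
  exact: continuous_atan.
have c2 : {for z, continuous (fun z => - ln (cmod z))}.
  apply: continuousN; apply: (@continuous_comp _ _ _ (@cmod R) (@ln R)).
    exact: continuous_cmod.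
  by apply: continuous_ln; exact: cre_gt0_cmod.
exact: cvg_cpx c1 c2.
Qed.

Lemma logi1 : logi 1 = 0.
Proof.
rewrite /logi/= /cre /cim/= mul0r atan0.
by rewrite /cmod /cre /cim/= expr1n expr0n addr0 sqrtr1 ln1 oppr0.
Qed.

Lemma is_derive_logi z : 0 < cre z -> is_derive z 1 logi (cpx 0 1 * z)^-1.
Proof.
move=> z0.
apply: (@is_derive_local_inverse _ expi _ (logi z)) => //.
- exact: logiK.
- exact: continuous_logi.
- have : \forall y \near z, 0 < cre y.
    have z0' : \forall x \near cre z, 0 < x by exact: lt_nbhsr.
    exact: (@cre_continuous R z _ z0').
  by apply: filterS => y; exact: logiK.
- have := is_derive_expi (logi z); rewrite logiK//.
- rewrite mulf_neq0//.
    by rewrite eq_complex/= oner_eq0 andbF.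
  by apply/negP => /eqP z00; move: z0; rewrite z00 /cre/= ltxx.
Qed.

End Expi.

(** * A function with zero derivative on a connected open set is constant *)

Section ZeroDerivative.
Variable R : realType.
Local Notation C := (Cplx R).
Implicit Types (x y z w : C).

Lemma nbhs_cmodP z (P : set C) : nbhs z P <->
  exists2 r : R, 0 < r & forall w, cmod (z - w) < r -> P w.
Proof.
split=> [/nbhs_ballP[e /= /gt0_real[r r0 ->] zP]|[r r0 zP]].
  exists r => // w wr; apply: zP.
  by rewrite -ball_normE /= normC_cmod ltC_real.
apply/nbhs_ballP; exists (cpx r 0); first by rewrite /= ltC_real.
by move=> w; rewrite -ball_normE /= normC_cmod ltC_real => /zP.
Qed.

(** Restricting to a line gives real functions of a real variable, to which the mean value theorem
    applies. The factor [u] selects the real part of [f] for [u = 1] and its imaginary part for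
    [u = - i]. *)
Lemma is_derive_cre_line (f : C -> C) (u v z d : C) (t : R) :
  is_derive (z + cpx t 0 * v) 1 f d ->
  is_derive t 1 (fun s => cre (u * f (z + cpx s 0 * v))) (cre (u * (d * v))).
Proof.
move=> /is_derive_slopeP[h [fE hc <-]].
apply: (@is_derive_slope _ _ (fun s => cre (u * (h (z + cpx s 0 * v) * v)))).
  near=> s; rewrite -creB -mulrBr fE.
  have -> : z + cpx s 0 * v - (z + cpx t 0 * v) = v * cpx (s - t) 0.
    by rewrite opprD addrACA subrr add0r -mulrBl cpxB subrr mulrC.
  rewrite !mulrA; set a := u * _ * v; case: a => a b.
  by rewrite /cre/= mulr0 subr0.
apply: (@continuous_comp _ _ _
  (fun s => u * (h (z + cpx s 0 * v) * v)) (@cre R));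
  last exact: cre_continuous.
apply: continuousM; first exact: cst_continuous.
apply: continuousM; last exact: cst_continuous.
apply: (@continuous_comp _ _ _ (fun s => z + cpx s 0 * v) h); last exact: hc.
apply: continuousD; first exact: cst_continuous.
apply: continuousM; last exact: cst_continuous.
by apply: cvg_cpx; [exact: cvg_id|exact: cvg_cst].
Unshelve. all: by end_near. Qed.

Lemma derive0_locally_cst (f : C -> C) z :
  (\forall w \near z, is_derive (w : C) 1 f 0) -> \forall w \near z, f w = f z.
Proof.
move=> /nbhs_cmodP[r r0 df]; apply/nbhs_cmodP; exists r => // w wr.
have line u : cre (u * f w) = cre (u * f z).
  pose k s := cre (u * f (z + cpx s 0 * (w - z))).
  have dk (s : R) : s \in `[0, 1] -> is_derive s 1 k 0.
    rewrite in_itv/= => /andP[s0 s1].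
    rewrite (_ : 0 = cre (u * (0 * (w - z)))); last by rewrite mul0r mulr0.
    apply: is_derive_cre_line; apply: df.
    rewrite opprD addNKr cmodN cmodM -[cmod (w - z)]cmodN opprB.
    rewrite /cmod/= expr0n addr0 sqrtr_sqr ger0_norm//.
    by rewrite (le_lt_trans _ wr)// ler_piMl// cmod_ge0.
  have k1 : k 1 = cre (u * f w) by rewrite /k mul1r subrKC.
  have k0 : k 0 = cre (u * f z) by rewrite /k mul0r addr0.
  rewrite -k1 -k0; move: k dk {k1 k0} => k dk.
  have kc : {within `[0, 1], continuous k}.
    by apply: derivable_within_continuous => x /dk dx; exact: ex_derive.
  have dk' (s : R) : s \in `]0, 1[ -> is_derive s 1 k ((fun=> 0) s).
    by rewrite in_itv/= => /andP[x0 x1]; apply: dk; rewrite in_itv/= !ltW.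
  have [c _ kE] := MVT_segment ler01 dk' kc.
  by apply/eqP; rewrite -subr_eq0 kE mul0r.
have := line 1; rewrite !mul1r => re.
have := line (cpx 0 (-1)).
rewrite -[f w](cpxK (f w)) -[f z](cpxK (f z)) !cpxM /cre/=.
rewrite !mul0r !mulN1r !sub0r !opprK.
by rewrite -!/(cre _) re => ->.
Unshelve. all: by end_near. Qed.

(** By local constancy, both the level set of [f w] in [A] and its complement in [A] are open, so
    connectedness makes the level set all of [A]. *)
Lemma derive0_cst (A : set C) (f : C -> C) : open A -> connected A ->
  (forall z, A z -> is_derive z 1 f 0) -> {in A &, forall z w, f z = f w}.
Proof.
move=> oA cA df z w; rewrite !inE => Az Aw.
have lc y : A y -> \forall x \near y, A x /\ f x = f y.
  move=> Ay; have nA : \forall x \near y, A x by exact: open_nbhs_nbhs.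
  near=> x; split; near: x => //; apply: derive0_locally_cst.
  by apply: filterS nA => x; exact: df.
have oU P : open [set x | A x /\ P (f x)].
  rewrite openE => y [Ay Py]; have := lc _ Ay; rewrite /interior.
  by apply: filterS => x [Ax fx]; rewrite /= fx.
have E : [set x | A x /\ f x = f w] = A.
  apply: cA; first by exists w.
    exists [set x | A x /\ f x = f w]; first exact: (oU (fun c => c = f w)).
    by apply/seteqP; split=> [x [Ax fx]|x [Ax [_ fx]]]; split.
  exists (~` [set x | A x /\ f x <> f w]).
    by apply: open_closedC; exact: (oU (fun c => c <> f w)).
  apply/seteqP; split=> [x [Ax fx]|x [Ax fx]]; split => //; first by case.
  by apply: contrapT => fxw; apply: fx.
by have : A z by []; rewrite -E => -[].
Unshelve. all: by end_near. Qed.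

End ZeroDerivative.

(** * The strip, the inverse of [expi] on it, and the function on its image *)

Section Strip.
Variable R : realType.
Local Notation C := (Cplx R).
Implicit Types (z w v : C) (x y : R).

Definition phase w : R := expR (2 * cim w) - cre w.

(* An open neighbourhood of the closed strip [0 <= phase w <= 1, 1 <= cre w]
   on which [expi] is still injective, its width [2] in the [cre] direction
   being less than [2 * pi]. *)
Definition wide_strip : set C :=
  [set w | 0 < cre w /\ - 2^-1 < phase w < 3 / 2].

Definition strip : set C :=
  [set w | 0 < phase w < 1 /\ 1 < cre w * (phase w * (1 - phase w))].

Lemma continuous_phase : continuous phase.
Proof.
move=> w; apply: (@continuousB _ _ _ (fun w => expR (2 * cim w)) (@cre R));
  last exact: cre_continuous.
apply: (@continuous_comp _ _ _ (fun w => 2 * cim w) (@expR R)).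
  by apply: continuousM; [exact: cst_continuous|exact: cim_continuous].
exact: continuous_expR.
Qed.

Lemma near_wide_strip w : wide_strip w -> \forall v \near w, wide_strip v.
Proof.
move=> [w0 /andP[wl wr]].
have n0 : \forall v \near w, 0 < cre v.
  exact: (@cre_continuous R w _ (lt_nbhsr w0)).
have nl : \forall v \near w, - 2^-1 < phase v.
  exact: (@continuous_phase w _ (lt_nbhsr wl)).
have nr : \forall v \near w, phase v < 3 / 2.
  exact: (@continuous_phase w _ (lt_nbhsl wr)).
by apply: filterS3 n0 nl nr => v v0 vl vr; split=> //; apply/andP.
Qed.

Lemma near_strip w : strip w -> \forall v \near w, strip v.
Proof.
move=> [/andP[wl wr] w1].
have nl : \forall v \near w, 0 < phase v.
  exact: (@continuous_phase w _ (lt_nbhsr wl)).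
have nr : \forall v \near w, phase v < 1.
  exact: (@continuous_phase w _ (lt_nbhsl wr)).
have c1 : {for w, continuous (fun v => cre v * (phase v * (1 - phase v)))}.
  apply: continuousM; first exact: cre_continuous.
  apply: continuousM; first exact: continuous_phase.
  by apply: (@continuousB _ _ _ (fun=> 1 : R) phase);
    [exact: cst_continuous|exact: continuous_phase].
have n1 : \forall v \near w, 1 < cre v * (phase v * (1 - phase v)).
  exact: (c1 _ (lt_nbhsr w1)).
by apply: filterS3 n1 nl nr => v v0 vl vr; split=> //; apply/andP.
Qed.

(** This is [p * (1 - p) <= 1 / 4] applied to the phase. *)
Lemma strip_cre_gt4 w : strip w -> 4 < cre w.
Proof.
case=> /andP[p0 p1]; set p := phase w in p0 p1 *; set x := cre w => xp.
have pp0 : 0 < p * (1 - p) by rewrite mulr_gt0// subr_gt0.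
have pp : p * (1 - p) <= 4^-1.
  rewrite -subr_ge0 (_ : _ - _ = (p - 2^-1) ^+ 2) ?sqr_ge0//.
  by field.
have x0 : 0 < x by rewrite -(pmulr_lgt0 _ pp0) (lt_trans ltr01).
have : x * (p * (1 - p)) <= x * 4^-1 by rewrite ler_wpM2l// ltW.
move: xp; set k := x * (p * (1 - p)) => ? ?; lra.
Qed.

Lemma strip_wide w : strip w -> wide_strip w.
Proof.
move=> Sw; have := strip_cre_gt4 Sw; case: Sw => /andP[p0 p1] _ x4.
by split; [lra|apply/andP; split; lra].
Qed.

(** Equal moduli give equal [cim]. The [cre] then differ by as much as the phases, hence by less
    than [2 <= pi], and the cosine of this difference is [1]. *)
Lemma expi_inj_wide : {in wide_strip &, injective (@expi R)}.
Proof.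
move=> w v; rewrite !inE => -[w0 /andP[wl wr]] [v0 /andP[vl vr]] E.
have iE : cim w = cim v.
  have /expR_inj/oppr_inj// : expR (- cim w) = expR (- cim v).
  by rewrite -!cmod_expi E.
have [cE sE] := cpx_inj E.
have N0 : expR (- cim v) != 0 by rewrite gt_eqF ?expR_gt0.
have {}cE : cos (cre w) = cos (cre v).
  by apply: (mulfI N0); rewrite -[in LHS]iE.
have {}sE : sin (cre w) = sin (cre v).
  by apply: (mulfI N0); rewrite -[in LHS]iE.
have d1 : cos `|cre w - cre v| = cos 0.
  rewrite cos_norm cosB cE sE cos0.
  by rewrite -[RHS](cos2Dsin2 (cre v)) !expr2.
have d2 : `|cre w - cre v| < 2.
  move: wl wr vl vr; rewrite /phase iE ltr_norml => *.
  by apply/andP; split; lra.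
have pi2 := @pi_ge2 R.
have /eqP : `|cre w - cre v| = 0.
  by apply: cos_inj d1; rewrite in_itv/= ?lexx ?normr_ge0/=; lra.
rewrite normr_eq0 subr_eq0 => /eqP rE.
by rewrite -[w]cpxK -[v]cpxK rE iE.
Qed.

Definition chart z : C := xget 0 [set w | wide_strip w /\ expi w = z].

Lemma chartK w : wide_strip w -> chart (expi w) = w.
Proof.
move=> Ww; rewrite /chart; case: xgetP => [v _ [Wv Ev]|/(_ w)]; last first.
  by move=> /(_ (conj Ww erefl)).
by apply: expi_inj_wide; rewrite ?inE.
Qed.

(** The branch of [- i log z] near [expi w] that takes the value [w] at [expi w]. It carries the
    regularity that the pointwise choice in [chart] does not show. *)
Definition local_log w z : C := w + logi (z / expi w).

Lemma continuous_local_log w : {for expi w, continuous (local_log w)}.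
Proof.
rewrite /local_log; apply: continuousD; first exact: cst_continuous.
apply: (@continuous_comp _ _ _ (fun z => z / expi w) (@logi R)).
  by apply: continuousM; [exact: cvg_id|exact: cst_continuous].
by rewrite divff ?expi_neq0//; apply: continuous_logi; rewrite /cre/= ltr01.
Qed.

Lemma local_log_expi w : local_log w (expi w) = w.
Proof. by rewrite /local_log divff ?expi_neq0// logi1 addr0. Qed.

Lemma near_local_logK w : \forall z \near expi w, expi (local_log w z) = z.
Proof.
have c1 : {for expi w, continuous (fun z => cre (z / expi w))}.
  apply: (@continuous_comp _ _ _ (fun z => z / expi w) (@cre R)).
    by apply: continuousM; [exact: cvg_id|exact: cst_continuous].
  exact: cre_continuous.
have p1 : 0 < cre (expi w / expi w) by rewrite divff ?expi_neq0// /cre/= ltr01.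
have n1 : \forall z \near expi w, 0 < cre (z / expi w).
  exact: (c1 _ (lt_nbhsr p1)).
apply: filterS n1 => z z0.
by rewrite /local_log expiD logiK// mulrC divfK// expi_neq0.
Qed.

(** By continuity [local_log w z] stays in the open set [wide_strip], and [expi] sends it to [z];
    injectivity on [wide_strip] identifies it with [chart z]. *)
Lemma near_chartE w : wide_strip w ->
  \forall z \near expi w, chart z = local_log w z /\ expi (chart z) = z.
Proof.
move=> Ww.
have nW : \forall v \near local_log w (expi w), wide_strip v.
  by rewrite local_log_expi; exact: near_wide_strip.
have := continuous_local_log nW.
apply: filterS2 (near_local_logK w) => z Ez Wz.
have chz : chart z = local_log w z by rewrite -[in LHS]Ez chartK.
by rewrite chz.
Qed.

Lemma continuous_chart w : wide_strip w -> {for expi w, continuous chart}.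
Proof.
move=> Ww; rewrite forE /continuous_at chartK//.
rewrite -[X in _ --> X](local_log_expi w).
apply: cvg_trans (@continuous_local_log w).
have nE : \forall z \near expi w, local_log w z = chart z.
  by apply: filterS (near_chartE Ww) => z [].
exact: near_eq_cvg nE.
Qed.

Lemma is_derive_chart w : wide_strip w ->
  is_derive (expi w) 1 chart (cpx 0 1 * expi w)^-1.
Proof.
move=> Ww.
apply: (@is_derive_local_inverse _ (@expi R) _ w) => //.
- exact: chartK.
- exact: continuous_chart.
- by apply: filterS (near_chartE Ww) => z [].
- exact: is_derive_expi.
- rewrite mulf_neq0 ?expi_neq0//.
  by rewrite eq_complex/= oner_eq0 andbF.
Qed.

Definition spiral_domain : set C := @expi R @` strip.

Lemma open_spiral_domain : open spiral_domain.
Proof.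
rewrite openE => _ [w Sw <-]; have Ww := strip_wide Sw.
have nS : \forall v \near chart (expi w), strip v.
  by rewrite chartK//; exact: near_strip.
have := continuous_chart Ww nS.
rewrite /interior; apply: filterS2 (near_chartE Ww) => z [_ Ez] Sz.
by exists (chart z).
Qed.

(** At [z = 0] the convention [0^-1 = 0] gives the value [0], which is the one needed for continuity
    at the end of the spiral. *)
Definition spiral_fun z : C := - (chart z * z)^-1.

(** The two factors [i] of the chain rule combine into the sign of [spiral_fun]; the principal
    branch in [logi] suffices because [0 < cre w]. *)
Lemma is_derive_log_chart w : wide_strip w ->
  is_derive (expi w) 1 (@logi R \o chart) (spiral_fun (expi w)).
Proof.
move=> Ww; have [w0 _] := Ww.
have -> : spiral_fun (expi w) = (cpx 0 1 * w)^-1 * (cpx 0 1 * expi w)^-1.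
  rewrite /spiral_fun chartK// -invfM mulrACA.
  have -> : cpx 0 1 * cpx 0 1 = -1 :> C.
    by rewrite cpxM !mul0r !mulr0 mul1r sub0r addr0 -[RHS]/(cpx _ _) oppr0.
  by rewrite mulN1r invrN.
apply: is_derive_compose; last exact: is_derive_chart.
by rewrite chartK//; exact: is_derive_logi.
Qed.

Lemma derivable_spiral_fun w : wide_strip w ->
  derivable spiral_fun (expi w) 1.
Proof.
move=> Ww; have [w0 _] := Ww.
have [dc _] := is_derive_chart Ww.
rewrite /spiral_fun; apply: derivableN; apply: derivableV.
  rewrite chartK// mulf_neq0 ?expi_neq0//.
  by apply/negP => /eqP w00; move: w0; rewrite w00 /cre/= ltxx.
by apply: derivableM; [exact: dc|exact: derivable_id].
Qed.

End Strip.

(** * The spiral in the coordinates [q = 1 / cre w] and [t = phase w] *)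

Section Spiral.
Variable R : realType.
Local Notation C := (Cplx R).
Implicit Types (z w v : C) (c q s t x y : R).

(* [spiral q t] is [expi w] for the [w] with [cre w = q^-1] and [phase w = t].
   At [q = 0] the modulus vanishes, so that [0^-1 = 0] does no harm: the segment
   [q = 0] is collapsed to the end [0] of the spiral. *)
Definition spiral q t : C :=
  cpx (Num.sqrt (q / (1 + t * q)) * cos q^-1)
      (Num.sqrt (q / (1 + t * q)) * sin q^-1).

Lemma cmod_spiral q t : cmod (spiral q t) = Num.sqrt (q / (1 + t * q)).
Proof.
rewrite /cmod /spiral /cre /cim/= !exprMn -mulrDr cos2Dsin2 mulr1.
by rewrite sqrtr_sqr ger0_norm ?sqrtr_ge0.
Qed.

Lemma spiral0 t : spiral 0 t = 0.
Proof. by apply/eqP; rewrite -cmod_eq0 cmod_spiral mul0r sqrtr0. Qed.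

Lemma cvg_spiral {T : Type} {F : set_system T} {FF : Filter F} (f g : T -> R)
    q t : 0 <= q -> 0 <= t -> f @ F --> q -> g @ F --> t ->
  (fun u => spiral (f u) (g u)) @ F --> spiral q t.
Proof.
move=> q0 t0 fq gt.
have rho : (fun u => Num.sqrt (f u / (1 + g u * f u))) @ F -->
    Num.sqrt (q / (1 + t * q)).
  have d0 : 1 + t * q != 0 by rewrite gt_eqF// ltr_wpDr// mulr_ge0.
  have h : (fun u => f u / (1 + g u * f u)) @ F --> q / (1 + t * q).
    apply: cvgM => //; apply: cvgV => //.
    by apply: cvgD; [exact: cvg_cst|exact: cvgM].
  exact: (continuous_cvg _ (@sqrt_continuous R _) h).
(* At [q = 0] the angle [q^-1] has no limit, but the modulus tends to [0]. *)
have [q00|qn0] := eqVneq q 0.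
  rewrite q00 spiral0; apply/cvg_cmodP => e e0.
  move: rho; rewrite q00 mul0r sqrtr0 => /cvgrPdist_lt /(_ e e0).
  by apply: filterS => u; rewrite !sub0r cmodN cmod_spiral normrN;
    rewrite ger0_norm ?sqrtr_ge0.
have fV : (fun u => (f u)^-1) @ F --> q^-1 by exact: cvgV.
apply: cvg_cpx; apply: cvgM => //.
  exact: (continuous_cvg _ (@continuous_cos R _) fV).
exact: (continuous_cvg _ (@continuous_sin R _) fV).
Qed.

(** The imaginary part solves [phase w = t] for [cre w = q^-1]. *)
Definition strip_point q t : C := cpx q^-1 (ln (q^-1 + t) / 2).

Lemma phase_strip_point q t : 0 < q -> 0 <= t -> phase (strip_point q t) = t.
Proof.
move=> q0 t0; rewrite /phase /strip_point /cre /cim/= mulrC divfK//.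
by rewrite lnK ?posrE ?ltr_wpDr ?invr_gt0// [q^-1 + t]addrC addrK.
Qed.

Lemma spiralE q t : 0 < q -> 0 <= t -> spiral q t = expi (strip_point q t).
Proof.
move=> q0 t0; rewrite /spiral /expi /strip_point/=.
suff -> : expR (- (ln (q^-1 + t) / 2)) = Num.sqrt (q / (1 + t * q)) by [].
have a0 : 0 < q^-1 + t by rewrite ltr_wpDr// invr_gt0.
have -> : q / (1 + t * q) = (q^-1 + t)^-1.
  by rewrite -invf_div mulrDl mul1r mulfK// gt_eqF.
rewrite -[LHS]ger0_norm ?expR_ge0// -sqrtr_sqr; congr Num.sqrt.
rewrite expr2 -expRD -opprD -splitr expRN lnK//.
Qed.

Lemma strip_point_phase w : 0 < cre w -> w = strip_point (cre w)^-1 (phase w).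
Proof.
move=> w0; rewrite /strip_point invrK /phase subrKC expRK mulrC mulKf//.
by rewrite cpxK.
Qed.

Lemma cmod_expi_phase w : cmod (expi w) ^+ 2 = (phase w + cre w)^-1.
Proof.
by rewrite cmod_expi /phase subrK -expRN expr2 -expRD -opprD -mulr2n mulr_natl.
Qed.

(** A closed set containing the strip and its boundary, still inside [wide_strip], so that [chart]
    and the estimate below reach the boundary. *)
Definition slab : set C := [set w | 1 <= cre w /\ 0 <= phase w <= 1].

Lemma slab_wide w : slab w -> wide_strip w.
Proof. by move=> [w1 /andP[p0 p1]]; split; [lra|apply/andP; split; lra]. Qed.

(** With [r = cmod (expi w)], the left side is [1 / (cmod w * r)]. Since [r ^+ 2 = 1 / (t + x)], the
    claim amounts to [t + x <= 2 * cmod w], true because [t <= 1 <= x <= cmod w]. *)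
Lemma spiral_fun_slab w : slab w ->
  cmod (spiral_fun (expi w)) <= 2 * cmod (expi w).
Proof.
move=> Sw; have Ww := slab_wide Sw; case: Sw => x1 /andP[p0 p1].
rewrite /spiral_fun chartK// cmodN cmodV cmodM.
have E := cmod_expi_phase w.
have xw : cre w <= cmod w by rewrite (le_trans (ler_norm _))// cre_le_cmod.
have r0 : 0 < cmod (expi w) by rewrite cmod_expi expR_gt0.
set r := cmod (expi w) in E r0 *.
have px0 : 0 < phase w + cre w by lra.
have w0 : 0 < cmod w by lra.
rewrite -[leLHS]mul1r ler_pdivrMr ?mulr_gt0//.
have -> : 2 * r * (cmod w * r) = 2 * cmod w * r ^+ 2 by ring.
by rewrite E ler_pdivlMr// mul1r; lra.
Qed.

(** * The unit square as a common parameter space for the domain and its boundary *)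

Definition unit_square : set (R * R) := `[0, 1] `*` `[0, 1].

(* [p.1 = 1] gives the boundary curve and [0 < p.1 < 1, 0 < p.2 < 1] the domain;
   the rest of the square is sent to [0]. *)
Definition sweep (p : R * R) : C := spiral (p.1 * (p.2 * (1 - p.2))) p.2.

Lemma itv_mul1B_ge0 t : t \in `[0, 1] -> 0 <= t * (1 - t).
Proof. by rewrite in_itv/= => /andP[t0 t1]; rewrite mulr_ge0// subr_ge0. Qed.

Lemma mul1B_le4 t : t * (1 - t) <= 4^-1.
Proof.
rewrite -subr_ge0 (_ : _ - _ = (t - 2^-1) ^+ 2) ?sqr_ge0//.
by field.
Qed.

Lemma cvg_sweep {T : Type} {F : set_system T} {FF : Filter F} (f g : T -> R)
    c t : c \in `[0, 1] -> t \in `[0, 1] -> f @ F --> c -> g @ F --> t ->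
  (fun u => sweep (f u, g u)) @ F --> sweep (c, t).
Proof.
move=> c01 t01 fc gt; apply: cvg_spiral => //.
- rewrite mulr_ge0 ?itv_mul1B_ge0//.
  by move: c01; rewrite in_itv/= => /andP[].
- by move: t01; rewrite in_itv/= => /andP[].
- apply: cvgM => //; apply: cvgM => //.
  by apply: cvgB => //; exact: cvg_cst.
Qed.

Lemma sweep_slab (p : R * R) : unit_square p ->
  sweep p = 0 \/ 0 < p.1 * (p.2 * (1 - p.2)) /\
    slab (strip_point (p.1 * (p.2 * (1 - p.2))) p.2).
Proof.
case: p => c t [/= c01 t01].
have t4 := mul1B_le4 t; have t0' := itv_mul1B_ge0 t01.
move: c01 t01; rewrite !in_itv/= => /andP[c0 c1] /andP[t0 t1].
rewrite /sweep/=; set q := c * _.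
have q0 : 0 <= q by rewrite mulr_ge0.
have q1 : q <= 1 by rewrite mulr_ile1//; lra.
have [->|qn0] := eqVneq q 0; first by left; exact: spiral0.
have {}q0 : 0 < q by rewrite lt_neqAle eq_sym qn0.
right; split=> //; split; last by rewrite phase_strip_point// t0 t1.
by rewrite /strip_point/cre/= invf_ge1.
Qed.

(** Off the collapsed part, [expi] is inverted on the slab: the phase returns [t], the real part
    returns [c * (t * (1 - t))], and the nonzero factor [t * (1 - t)] cancels. *)
Lemma sweep_injective (p p' : R * R) : unit_square p -> unit_square p' ->
  sweep p != 0 -> sweep p = sweep p' -> p = p'.
Proof.
move=> pU pU' pn0 E.
have [p0|[q0 Sp]] := sweep_slab pU; first by rewrite p0 eqxx in pn0.
have [p0|[q0' Sp']] := sweep_slab pU'; first by rewrite E p0 eqxx in pn0.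
case: p p' {pn0} pU pU' q0 q0' Sp Sp' E => [c t] [c' t'] /=.
move=> [/= c01 t01] [/= c01' t01'].
rewrite /sweep/=; set q := c * _; set q' := c' * _ => q0 q0' Sp Sp'.
move: (t01) (t01'); rewrite !in_itv/= => /andP[t0 _] /andP[t0' _].
rewrite !spiralE// => /expi_inj_wide; rewrite !inE.
move=> /(_ (slab_wide Sp) (slab_wide Sp')) E.
have tE : t = t' by rewrite -(phase_strip_point q0 t0) E phase_strip_point.
have [/invr_inj qE _] := cpx_inj E.
congr pair => //.
move: q0 qE; rewrite /q /q' -tE => q0; apply: mulIf.
by apply: contraTneq q0 => ->; rewrite mulr0 ltxx.
Qed.

Lemma strip_sweep w : strip w -> exists p : R * R,
  [/\ 0 < p.1 < 1, 0 < p.2 < 1 & expi w = sweep p].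
Proof.
move=> Sw; have x4 := strip_cre_gt4 Sw; case: Sw => p01 xp.
have /andP[p0 p1] := p01.
have pp0 : 0 < phase w * (1 - phase w) by rewrite mulr_gt0// subr_gt0.
have x0 : 0 < cre w by lra.
(* The first coordinate solves [c * (t * (1 - t)) = (cre w)^-1]; it is less than [1] exactly by the
   second condition defining [strip]. *)
exists ((cre w * (phase w * (1 - phase w)))^-1, phase w); split=> //=.
  by rewrite invr_gt0 mulr_gt0//= invf_lt1// mulr_gt0.
rewrite /sweep/= invfM divfK ?gt_eqF// spiralE ?invr_gt0//; last exact: ltW.
by rewrite -strip_point_phase.
Qed.

Lemma sweep_strip (p : R * R) : 0 < p.1 < 1 -> 0 < p.2 < 1 ->
  spiral_domain (sweep p).
Proof.
case: p => c t /= /andP[c0 c1] /andP[t0 t1].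
have pp0 : 0 < t * (1 - t) by rewrite mulr_gt0// subr_gt0.
have q0 : 0 < c * (t * (1 - t)) by rewrite mulr_gt0.
exists (strip_point (c * (t * (1 - t))) t); last by rewrite -spiralE// ltW.
rewrite /strip /= phase_strip_point ?ltW// t0 t1; split=> //.
by rewrite /strip_point/cre/= mulrC ltr_pdivlMr// mul1r gtr_pMl.
Qed.

(** * The Jordan curve, and the topology of the domain relative to it *)

Definition border s : C := sweep (1, s).

Definition spiral_curve : set C := border @` `[0, 1].

Lemma in_unit_square (p : R * R) : p.1 \in `[0, 1] -> p.2 \in `[0, 1] ->
  unit_square p.
Proof. by move=> ? ?; split. Qed.

Lemma border0 : border 0 = 0.
Proof. by rewrite /border /sweep/= mul0r mulr0 spiral0. Qed.

Lemma border1 : border 1 = 0.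
Proof. by rewrite /border /sweep/= subrr !mulr0 spiral0. Qed.

Lemma border_neq0 s : 0 < s < 1 -> border s != 0.
Proof.
move=> /andP[s0 s1]; rewrite -cmod_eq0 cmod_spiral/= mul1r gt_eqF// sqrtr_gt0.
have q0 : 0 < s * (1 - s) by rewrite mulr_gt0// subr_gt0.
by rewrite divr_gt0// ltr_wpDr// mulr_ge0// ltW.
Qed.

Lemma in01_1 : (1 : R) \in `[0, 1].
Proof. by rewrite in_itv/= ler01 lexx. Qed.

Lemma is_jordan_curve_spiral : is_jordan_curve spiral_curve.
Proof.
exists border; split => //.
- apply: continuous_in_subspaceT => s; rewrite inE/= => s01.
  apply: (@cvg_sweep _ (nbhs s) _ (fun=> 1) id) => //; first exact: in01_1.
  exact: cvg_cst.
- by rewrite border0 border1.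
move=> s s'; rewrite !in_itv/= => /andP[s0 s1] /andP[s0' s1'].
have U x : 0 <= x -> x < 1 -> unit_square (1, x).
  by move=> x0 x1; apply: in_unit_square; rewrite ?in01_1// in_itv/= x0 ltW.
(* The parameter [0] is handled apart, since [sweep_injective] asks for a nonzero value. *)
have [->|sn0] := eqVneq s 0; have [->|sn0'] := eqVneq s' 0 => //.
- move/esym/eqP; rewrite border0 (negPf (border_neq0 _))//.
  by rewrite s1' lt_neqAle eq_sym sn0' s0'.
- move/eqP; rewrite border0 (negPf (border_neq0 _))//.
  by rewrite s1 lt_neqAle eq_sym sn0 s0.
move=> E.
have /(sweep_injective (U _ s0 s1) (U _ s0' s1'))/(_ E)[//] : border s != 0.
by rewrite border_neq0// s1 lt_neqAle eq_sym sn0 s0.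
Qed.

(** A common point would be a nonzero value of [sweep] taken both with [c < 1] and with [c = 1]. *)
Lemma spiral_domain_disjoint z : spiral_domain z -> ~ spiral_curve z.
Proof.
move=> [w /strip_sweep[[c t] [/= /andP[c0 c1] /andP[t0 t1] ->]] <-] [s s01 E].
have q0 : 0 < c * (t * (1 - t)) by rewrite !mulr_gt0// subr_gt0.
have n0 : border s != 0.
  rewrite E -cmod_eq0 cmod_spiral/= gt_eqF// sqrtr_gt0.
  by rewrite divr_gt0// ltr_wpDr// mulr_ge0// ltW.
have ct : unit_square (c, t) by apply: in_unit_square; rewrite in_itv/= !ltW.
have := sweep_injective (@in_unit_square (1, s) in01_1 s01) ct n0 E.
by case=> c1E _; move: c1; rewrite -c1E ltxx.
Qed.

(** As the image of the square is compact and contains the domain, this places every closure point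
    of the domain in the domain or on the curve. *)
Lemma sweep_cover : sweep @` unit_square `<=` @spiral_domain R `|` spiral_curve.
Proof.
move=> _ [[c t] pU <-].
have [p0|[/= q0 _]] := sweep_slab pU.
  by right; exists 0; rewrite ?border0 ?p0//= in_itv/= lexx ler01.
case: pU => /= c01 t01; move: (c01) (t01); rewrite !in_itv/=.
move=> /andP[c0 c1] /andP[t0 t1].
move: c1; rewrite le_eqVlt => /predU1P[cE|c1].
  by right; exists t => //; rewrite /border cE.
have pos (a b : R) : 0 <= a -> 0 <= b -> 0 < a * b -> 0 < a /\ 0 < b.
  move=> a0 b0 ab; split; rewrite lt_neqAle ?a0 ?b0 andbT eq_sym;
  by apply: contraTneq ab => ->; rewrite ?mul0r ?mulr0 ltxx.
have tB0 : 0 <= 1 - t by rewrite subr_ge0.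
have [c0' tt] := pos _ _ c0 (mulr_ge0 t0 tB0) q0.
have [t0' tB0'] := pos _ _ t0 tB0 tt.
left; apply: sweep_strip => /=; first by rewrite c0' c1.
by rewrite t0' -subr_gt0.
Qed.

Lemma closed_sweep : closed (sweep @` unit_square).
Proof.
apply: compact_closed; first exact: norm_hausdorff.
apply: continuous_compact; last first.
  by apply: compact_setX; exact: segment_compact.
apply: continuous_in_subspaceT => -[c t]; rewrite inE => -[/= c01 t01].
apply: (@cvg_sweep _ (nbhs (c, t)) _ fst snd) => //.
  exact: cvg_fst.
exact: cvg_snd.
Qed.

Lemma spiral_domain_sweep : @spiral_domain R `<=` sweep @` unit_square.
Proof.
move=> _ [w /strip_sweep[p [/andP[c0 c1] /andP[t0 t1] ->]] <-].
by exists p => //; apply: in_unit_square; rewrite in_itv/= !ltW.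
Qed.

Lemma closure_spiral_domain :
  closure (@spiral_domain R) `<=` sweep @` unit_square.
Proof.
rewrite [X in _ `<=` X]((closure_id _).1 closed_sweep).
exact: closureS spiral_domain_sweep.
Qed.

Lemma connected_spiral_domain : connected (@spiral_domain R).
Proof.
(* The image of the segment from the centre of the square to [p]: all these paths share their
   starting point, and together they fill the domain. *)
pose path (p : R * R) s := sweep ((1 - s) / 2 + s * p.1, (1 - s) / 2 + s * p.2).
pose I := [set p : R * R | 0 < p.1 < 1 /\ 0 < p.2 < 1].
have mid (x s : R) : 0 < x < 1 -> s \in `[0, 1] -> 0 < (1 - s) / 2 + s * x < 1.
  rewrite in_itv/= => /andP[x0 x1] /andP[s0 s1]; apply/andP; split; nra.
have -> : @spiral_domain R = \bigcup_(p in I) (path p @` `[0, 1]).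
  apply/seteqP; split=> [_ [w /strip_sweep[p [c01 t01 ->]] <-]|].
    exists p => //; exists 1; first exact: in01_1.
    by rewrite /path subrr !mul0r !add0r !mul1r; case: (p).
  by move=> _ [p [c01 t01]] [s s01 <-]; apply: sweep_strip; exact: mid.
apply: bigcup_connected.
  exists (path (0, 0) 0) => p _; exists 0.
    by rewrite /= in_itv/= lexx ler01.
  by rewrite /path !mul0r.
move=> p [c01 t01]; apply: connected_continuous_connected.
  exact: segment_connected.
apply: continuous_in_subspaceT => s; rewrite inE => s01.
have pc (x : R) : {for s, continuous (fun s => (1 - s) / 2 + s * x)}.
  apply: cvgD; apply: cvgM; try exact: cvg_cst; last exact: cvg_id.
  by apply: cvgB; [exact: cvg_cst|exact: cvg_id].
have sub (x : R) : 0 < x < 1 -> x \in `[0, 1].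
  by move=> /andP[x0 x1]; rewrite in_itv/= !ltW.
apply: (@cvg_sweep _ (nbhs s)).
- by apply: sub; exact: mid.
- by apply: sub; exact: mid.
- exact: pc.
- exact: pc.
Qed.

End Spiral.

(** [B] is open and, by the last hypothesis, closed relative to [A], so it cuts the component of [z]
    in a nonempty clopen part, which is everything. *)
Lemma connected_component_clopen (T : topologicalType) (A B : set T) (z : T) :
  B z -> B `<=` A -> connected B -> open B -> closure B `&` A `<=` B ->
  B = connected_component A z.
Proof.
move=> Bz BA cB oB clB; apply/seteqP; split.
  exact: connected_component_max.
have compA := @connected_component_sub T A z.
suff E : connected_component A z `&` B = connected_component A z.
  by rewrite -E => x [].
apply: component_connected.
- by exists z; split=> //; apply: connected_component_refl; exact: BA.
- by exists B.
- exists (closure B); first exact: closed_closure.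
  apply/seteqP; split=> x [xA xB]; split=> //; first exact: subset_closure.
  by apply: clB; split=> //; exact: compA.
Qed.

(** * The Jordan domain, membership in [in_A], and unboundedness of every antiderivative *)

Section Conclusion.
Variable R : realType.
Local Notation C := (Cplx R).
Local Notation Omega := (@spiral_domain R).
Implicit Types (z w : C).

Lemma is_jordan_domain_spiral : is_jordan_domain Omega.
Proof.
exists (@spiral_curve R); first exact: is_jordan_curve_spiral.
split.
  exists 1; split; first exact: real1.
  move=> M M1 _ [w Sw <-] /=; rewrite (le_trans _ (ltW M1))//.
  rewrite normC_cmod -[1 : C]/(cpx 1 0) leC_real.
  have x4 := strip_cre_gt4 Sw; case: Sw => /andP[p0 p1] _.
  (* The domain lies in the unit disc, as [cmod (expi w) ^+ 2 = 1 / (phase w + cre w)] with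
     [4 < cre w]. *)
  rewrite -(@expr_le1 _ 2)// ?cmod_ge0// cmod_expi_phase invf_le1; lra.
have half : 0 < (2^-1 : R) < 1 by apply/andP; split; lra.
have z0 : Omega (sweep (2^-1, 2^-1)) by exact: sweep_strip.
exists (sweep (2^-1, 2^-1)); first exact: spiral_domain_disjoint.
apply: connected_component_clopen => //.
- by move=> z; exact: spiral_domain_disjoint.
- exact: connected_spiral_domain.
- exact: open_spiral_domain.
- by move=> z [/closure_spiral_domain/sweep_cover[]].
Qed.

Lemma spiral_fun_small z : closure Omega z ->
  cmod (spiral_fun z) <= 2 * cmod z.
Proof.
move=> /closure_spiral_domain[p pU <-].
have [->|[q0 Sp]] := sweep_slab pU.
  rewrite /spiral_fun mulr0 invr0 oppr0.
  by have /eqP -> : cmod (0 : C) == 0; rewrite ?cmod_eq0// mulr0.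
have [_ /andP[t0 _]] := Sp; rewrite phase_strip_point// in t0 *.
  by rewrite /sweep spiralE//; exact: spiral_fun_slab.
by case: pU => _; rewrite /= in_itv/= => /andP[].
Qed.

Lemma continuous_spiral_fun :
  {within closure Omega, continuous (@spiral_fun R)}.
Proof.
apply/subspace_continuousP => z clz.
have [p pU pz] := closure_spiral_domain clz.
(* At [0] continuity holds relative to the closure and follows from the linear bound; at any other
   point of the closure the function is complex differentiable. *)
have [p0|[q0 Sp]] := sweep_slab pU.
  have z0 : z = 0 by rewrite -pz.
  have fz0 : spiral_fun z = 0 by rewrite z0 /spiral_fun mulr0 invr0 oppr0.
  apply/cvg_cmodP => e e0.
  have e20 : 0 < e / 2 by rewrite divr_gt0.
  have : \forall y \near z, closure Omega y -> cmod (spiral_fun y) < e.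
    apply/nbhs_cmodP; exists (e / 2) => // y; rewrite z0 sub0r cmodN => ye cly.
    by rewrite (le_lt_trans (spiral_fun_small cly))// mulrC -ltr_pdivlMr.
  by apply: filterS => y ye cly; rewrite -[X in X - _]/(spiral_fun z) fz0 sub0r;
    rewrite cmodN; exact: ye.
have t0 : 0 <= p.2 by case: pU => _; rewrite /= in_itv/= => /andP[].
have Ww := slab_wide Sp.
have fc : {for z, continuous (@spiral_fun R)}.
  rewrite -pz /sweep (spiralE q0 t0).
  exact/differentiable_continuous/derivable1_diffP/derivable_spiral_fun.
by apply: cvg_trans fc; apply: cvg_app; exact: cvg_within.
Qed.

Lemma in_A_spiral_fun : in_A Omega (@spiral_fun R).
Proof.
split.
  by move=> _ [w Sw <-]; apply: derivable_spiral_fun; exact: strip_wide.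
exists (@spiral_fun R) => //; exact: continuous_spiral_fun.
Qed.

Lemma antiderivative_spiral :
  antiderivative_on Omega (@spiral_fun R) (@logi R \o @chart R).
Proof.
split=> _ [w Sw <-]; have [dF FE] := is_derive_log_chart (strip_wide Sw).
  exact: dF.
by rewrite derive1E FE.
Qed.

(** This carries unboundedness from the explicit antiderivative to all others. *)
Lemma antiderivative_unique (f F G : C -> C) (A : set C) :
  open A -> connected A -> antiderivative_on A f F -> antiderivative_on A f G ->
  {in A &, forall z w, F z - G z = F w - G w}.
Proof.
move=> oA cA [hF dF] [hG dG].
apply: (@derive0_cst R A (F - G)) => // z Az.
have -> : (0 : C) = 'D_1 F z - 'D_1 G z by rewrite -!derive1E dF// dG// subrr.
by apply: is_deriveB; apply: DeriveDef; [exact: hF| |exact: hG|].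
Qed.

Lemma log_chart_unbounded (B : R) :
  exists2 z, Omega z & B < cmod (logi (chart z)).
Proof.
(* The summand [expR B] forces [ln x > B]; the [5] ensures [x / 4 > 1], the strip condition at phase
   [1 / 2]. *)
pose x := expR B + 5.
have x5 : 5 < x by rewrite /x ltrDr expR_gt0.
have x0 : 0 < x by lra.
pose w := strip_point x^-1 2^-1.
have cw : cre w = x by rewrite /w /strip_point /cre /= invrK.
have pw : phase w = 2^-1.
  by apply: phase_strip_point; rewrite ?invr_gt0// invr_ge0.
have Sw : strip w by split; rewrite pw ?cw; [apply/andP; split|]; lra.
exists (expi w); first by exists w.
rewrite chartK; last exact: strip_wide.
rewrite (lt_le_trans _ (cim_le_cmod _))//.
have xw : x <= cmod w.
  by rewrite -cw (le_trans (ler_norm _))// cre_le_cmod.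
rewrite /logi /cim /= normrN (lt_le_trans _ (ler_norm _))//.
by rewrite -ltr_expR lnK ?posrE; [rewrite /x in xw *; lra|lra].
Qed.

Lemma antiderivative_unbounded (F : C -> C) :
  antiderivative_on Omega (@spiral_fun R) F -> ~ bounded_on Omega F.
Proof.
move=> aF [M [Mreal bF]].
have {}bF z : Omega z -> cmod (F z) <= complex.Re M + 1.
  move=> Oz; have := bF (M + 1); rewrite ltrDl ltr01 => /(_ isT z Oz).
  case: M Mreal {bF} => m m'; rewrite complex_real => /eqP -> /=.
  by rewrite normC_cmod -/(cpx m 0) -[1 : C]/(cpx 1 0) cpxD addr0 leC_real.
have [z0 Oz0 _] := log_chart_unbounded 0.
pose c := F z0 - logi (chart z0).
(* The threshold is the bound assumed for [F] plus the modulus of the constant separating [F] from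
   [logi \o chart]. *)
have [z Oz] := log_chart_unbounded (complex.Re M + 1 + cmod c).
have Fz : logi (chart z) = F z + - c.
  have uniq := antiderivative_unique (@open_spiral_domain R)
    (@connected_spiral_domain R) aF antiderivative_spiral.
  have -> : c = F z - logi (chart z).
    exact: (uniq z0 z (mem_set Oz0) (mem_set Oz)).
  by rewrite opprB addrC subrK.
have := cmodD (F z) (- c); rewrite -Fz cmodN => le1 lt1.
have := bF z Oz; lra.
Qed.

End Conclusion.

Theorem proposition6p3 (R : realType) :
  exists (Omega : set (Cplx R)) (f : Cplx R -> Cplx R),
    [/\ is_jordan_domain Omega,
        in_A Omega f,
        (exists F : Cplx R -> Cplx R, antiderivative_on Omega f F) &
        (forall F : Cplx R -> Cplx R,
           antiderivative_on Omega f F -> ~ bounded_on Omega F)].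
Proof.
exists (@spiral_domain R), (@spiral_fun R); split.
- exact: is_jordan_domain_spiral.
- exact: in_A_spiral_fun.
- by exists (@logi R \o @chart R); exact: antiderivative_spiral.
- exact: antiderivative_unbounded.
Qed.
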